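(* (a) Every orthoalgebra is homogeneous. (b) Every effect algebra satisfying the Riesz decomposition property is homogeneous. (c) Every lattice ordered effect algebra is homogeneous.
   Context: An effect algebra is a partial algebra $(E;\oplus,0,1)$ with a partial binary operation $\oplus$ and two constants $0,1$ such that: (E1) if $a\oplus b$ is defined, then $b\oplus a$ is defined and $a\oplus b=b\oplus a$; (E2) if $a\oplus b$ and $(a\oplus b)\oplus c$ are defined, then $b\oplus c$ and $a\oplus(b\oplus c)$ are defined and $(a\oplus b)\oplus c=a\oplus(b\oplus c)$; (E3) for every $a\in E$ there is a unique $a'\in E$ with $a\oplus a'=1$; (E4) if $a\oplus 1$ is defined, then $a=0$. Write $a\le b$ iff there is $c\in E$ with $a\oplus c=b$; this is a partial order with least element $0$ and greatest element $1$. Write $a\perp b$ iff $a\oplus b$ is defined. An effect algebra is an orthoalgebra iff $a\perp a$ implies $a=0$. It is lattice ordered iff $(E,\le)$ is a lattice. It satisfies the Riesz decomposition property iff for all $u,v_1,\ldots,v_n\in E$ such that $v_1\oplus\cdots\oplus v_n$ exists and $u\le v_1\oplus\cdots\oplus v_n$, there are $u_1,\ldots,u_n\in E$ with $u_i\le v_i$ for all $1\le i\le n$ and $u=u_1\oplus\cdots\oplus u_n$. An effect algebra $E$ is homogeneous iff for all $u,v_1,v_2\in E$ such that $v_1\perp v_2$, $u\le v_1\oplus v_2$ and $u\le (v_1\oplus v_2)'$, there are $u_1,u_2\in E$ with $u_1\le v_1$, $u_2\le v_2$ and $u=u_1\oplus u_2$. *)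

(* Defs.v *)
From HB Require Import structures.
From mathcomp Require Import all_boot.
From mathcomp Require Import boolp.
From Stdlib Require Import Relation_Definitions.

Set Implicit Arguments.
Unset Strict Implicit.
Unset Printing Implicit Defensive.

(* The partial operation is option-valued: [oplus a b = Some c] reads
   "a (+) b is defined and equals c". *)
HB.mixin Record isEffectAlgebra (E : Type) := {
  oplus : E -> E -> option E;
  ezero : E;
  eone : E;
  oplusC : forall a b c, oplus a b = Some c -> oplus b a = Some c;
  oplusA : forall a b c ab abc, oplus a b = Some ab -> oplus ab c = Some abc ->
    exists2 bc, oplus b c = Some bc & oplus a bc = Some abc;
  oplus_ortho : forall a, exists! a', oplus a a' = Some eone;
  oplus_one : forall a, (exists c, oplus a eone = Some c) -> a = ezero
}.

#[short(type="effectAlgType")]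
HB.structure Definition EffectAlgebra := { E of isEffectAlgebra E }.

Section EffectAlgebraDefs.
Variable E : effectAlgType.
Implicit Types a b c u v w : E.

Definition ortho a : E := sval (cid (oplus_ortho a)).

Definition orthogonal a b : Prop := exists c, oplus a b = Some c.

Definition ele a b : Prop := exists c, oplus a c = Some b.

Definition is_lub a b c : Prop :=
  [/\ ele a c, ele b c & forall d, ele a d -> ele b d -> ele c d].

Definition is_glb a b c : Prop :=
  [/\ ele c a, ele c b & forall d, ele d a -> ele d b -> ele d c].

(* Extension of [oplus] to possibly undefined operands; undefinedness
   propagates. *)
Definition ooplus (x y : option E) : option E :=
  obind (fun a => obind (oplus a) y) x.

(* v_0 (+) ... (+) v_(n-1). The iteration ends with (+) 0, which is harmless by
   [oplus0] below; bracketing and order are irrelevant by associativity and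
   commutativity. *)
Definition osum n (v : 'I_n -> E) : option E :=
  \big[ooplus/Some (ezero : E)]_(i < n) Some (v i).

End EffectAlgebraDefs.

Definition orthoalgebra (E : effectAlgType) : Prop :=
  forall a : E, orthogonal a a -> a = ezero.

(* That [ele] is a partial order is [ele_order] below. *)
Definition lattice_ordered (E : effectAlgType) : Prop :=
  forall a b : E, (exists c, is_lub a b c) /\ (exists c, is_glb a b c).

Definition riesz_decomposition (E : effectAlgType) : Prop :=
  forall (n : nat) (u : E) (v : 'I_n -> E) (w : E), 0 < n ->
    osum v = Some w -> ele u w ->
    exists2 u_ : 'I_n -> E, (forall i, ele (u_ i) (v i)) & osum u_ = Some u.

Definition homogeneous (E : effectAlgType) : Prop :=
  forall u v1 v2 w : E,
    oplus v1 v2 = Some w -> ele u w -> ele u (ortho w) ->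
    exists u1 u2 : E, [/\ ele u1 v1, ele u2 v2 & oplus u1 u2 = Some u].

Section EffectAlgebraTheory.
Variable E : effectAlgType.
Implicit Types a b c : E.

Lemma orthoP a : oplus a (ortho a) = Some eone.
Proof. by rewrite /ortho; case: cid => a' [/= H _]. Qed.

Lemma ortho_uniq a b : oplus a b = Some eone -> b = ortho a.
Proof. by rewrite /ortho; case: cid => a' [/= _ H] /H. Qed.

Lemma one_oplus0 : oplus (eone : E) ezero = Some eone.
Proof.
have H := orthoP (eone : E).
have <- // : ortho (eone : E) = ezero.
by apply: oplus_one; exists eone; apply: oplusC.
Qed.

Lemma oplus0 a : oplus a ezero = Some a.
Proof.
have Ha := oplusC _ _ _ (orthoP a).
have [f -> Hf] := oplusA _ _ _ _ _ Ha one_oplus0.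
by rewrite (ortho_uniq Hf) -(ortho_uniq Ha).
Qed.

Lemma ele0 a : ele ezero a.
Proof. by exists a; apply/oplusC/oplus0. Qed.

Lemma ele1 a : ele a eone.
Proof. by exists (ortho a); apply: orthoP. Qed.

Lemma ele_order : order E (@ele E).
Proof.
split=> [a|a b c [d Hd] [e He]|a b [c Hc] [d Hd]].
- by exists ezero; apply: oplus0.
- by have [f _ Hf] := oplusA _ _ _ _ _ Hd He; exists f.
have [f Hcd Haf] := oplusA _ _ _ _ _ Hc Hd.
have f0 : f = ezero.
  have [g Hg Hfg] := oplusA _ _ _ _ _ (oplusC _ _ _ Haf) (orthoP a).
  apply: oplus_one; exists eone.
  by move: Hg Hfg; rewrite orthoP => -[<-].
rewrite {}f0 in Hcd.
have c0 : c = ezero.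
  have [g Hg _] := oplusA _ _ _ _ _ (oplusC _ _ _ Hcd) (oplusC _ _ _ one_oplus0).
  by apply: oplus_one; exists g.
by move: Hc; rewrite c0 oplus0 => -[].
Qed.

End EffectAlgebraTheory.

(* Main.v *)
Require Import Defs.
From mathcomp Require Import all_boot.

(** The hypothesis [u <= ortho w] says that [u] and [w = v1 (+) v2] are
    orthogonal.

    In an orthoalgebra, this and [u <= w] make [u] orthogonal to itself, so [u]
    is zero and both parts can be taken to be zero.

    The Riesz decomposition property for two summands splits every [u <= w].

    In the lattice case, orthogonality of [u] and [w] and [v1 <= w] show that
    [s = v1 (+) u] exists, and the join [j] of [u] and [v1] lies below both [w]
    and [s]. The parts of [u] are the two gaps [u2 = j (-) v1] and
    [u1 = s (-) j]. They add up to [s (-) v1 = u]; [u2] is at most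
    [w (-) v1 = v2], and [u1] is at most [s (-) u = v1]. The same computation
    works for any [j] above [u] and [v1] and below [w] and [s]
    ([decomposition_of_interpolant]). *)

Set Implicit Arguments.
Unset Strict Implicit.
Unset Printing Implicit Defensive.

Section EffectAlgebra.
Variable E : effectAlgType.
Implicit Types a b c d j s u v w : E.

(** Adding the orthosupplement of [c] to both sides makes [b] and [b'] the
    orthosupplements of one and the same element [a (+) ortho c]. *)
Lemma oplus_cancel a b b' c :
  oplus a b = Some c -> oplus a b' = Some c -> b = b'.
Proof.
move=> /oplusC Hb /oplusC Hb'.
have [e He Hbe] := oplusA _ _ _ _ _ Hb (orthoP c).
have [e' He' Hbe'] := oplusA _ _ _ _ _ Hb' (orthoP c).
move: He'; rewrite He => -[eq_e]; rewrite -{e'}eq_e in Hbe'.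
by rewrite (ortho_uniq (oplusC _ _ _ Hbe)) -(ortho_uniq (oplusC _ _ _ Hbe')).
Qed.

Lemma ele_oplusl a b c : oplus a b = Some c -> ele a c.
Proof. by exists b. Qed.

Lemma ele_oplusr a b c : oplus a b = Some c -> ele b c.
Proof. by exists a; apply: oplusC. Qed.

(** Removing the common summand [a] keeps differences: the identity
    [s (-) c = d (-) b], which also gives [b <= d] from [c <= s]. *)
Lemma oplus_gap a b c d s g :
  oplus a b = Some c -> oplus a d = Some s -> oplus c g = Some s ->
  oplus b g = Some d.
Proof.
move=> Hab Had Hcg.
have [d' Hd' Had'] := oplusA _ _ _ _ _ Hab Hcg.
by rewrite Hd' (oplus_cancel Had' Had).
Qed.

Lemma orthogonal_ele_ortho a b : ele a (ortho b) -> orthogonal a b.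
Proof.
case=> k /oplusC Hk.
by have [c Hc _] := oplusA _ _ _ _ _ Hk (oplusC _ _ _ (orthoP b)); exists c.
Qed.

Lemma orthogonal_ele a b c : ele b c -> orthogonal a c -> orthogonal b a.
Proof.
case=> d /oplusC Hd [s /oplusC Hs].
by have [t Ht _] := oplusA _ _ _ _ _ Hd Hs; exists t.
Qed.

(** The decomposition splits [v1 <= j <= v1 (+) u] into its two steps. *)
Lemma decomposition_of_interpolant u v1 v2 w s j :
  oplus v1 v2 = Some w -> oplus v1 u = Some s ->
  ele u j -> ele v1 j -> ele j w -> ele j s ->
  exists u1 u2, [/\ ele u1 v1, ele u2 v2 & oplus u1 u2 = Some u].
Proof.
move=> Hw Hs [h Hh] [u2 Hu2] [k Hk] [u1 Hu1].
exists u1, u2; split.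
- exact: ele_oplusr (oplus_gap Hh (oplusC _ _ _ Hs) Hu1).
- exact: ele_oplusl (oplus_gap Hu2 Hw Hk).
- exact/oplusC/(oplus_gap Hu2 Hs Hu1).
Qed.

Lemma osum2 (v : 'I_2 -> E) : osum v = oplus (v ord0) (v (lift ord0 ord0)).
Proof. by rewrite /osum !big_ord_recl big_ord0 /= oplus0. Qed.

Lemma homogeneous_orthoalgebra : orthoalgebra E -> homogeneous E.
Proof.
move=> orthoE u v1 v2 w _ le_uw /orthogonal_ele_ortho perp_uw.
have -> : u = ezero by apply: orthoE; apply: orthogonal_ele le_uw perp_uw.
by exists ezero, ezero; split; [exact: ele0 | exact: ele0 | exact: oplus0].
Qed.

Lemma homogeneous_riesz : riesz_decomposition E -> homogeneous E.
Proof.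
move=> rieszE u v1 v2 w Hw le_uw _.
pose v (i : 'I_2) := if i == ord0 then v1 else v2.
have Hv : osum v = Some w by rewrite osum2.
have [u_ le_uv] := rieszE 2 u v w isT Hv le_uw.
rewrite osum2 => Hu; exists (u_ ord0), (u_ (lift ord0 ord0)).
by split.
Qed.

Lemma homogeneous_lattice : lattice_ordered E -> homogeneous E.
Proof.
move=> latE u v1 v2 w Hw le_uw /orthogonal_ele_ortho perp_uw.
have [s Hs] : orthogonal v1 u := orthogonal_ele (ele_oplusl Hw) perp_uw.
have [[j [le_uj le_v1j j_min]] _] := latE u v1.
apply: (decomposition_of_interpolant Hw Hs le_uj le_v1j); apply: j_min.
- exact: le_uw.
- exact: ele_oplusl Hw.
- exact: ele_oplusr Hs.
- exact: ele_oplusl Hs.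
Qed.

End EffectAlgebra.

Theorem proposition2p2 :
  (forall E : effectAlgType, orthoalgebra E -> homogeneous E) /\
  (forall E : effectAlgType, riesz_decomposition E -> homogeneous E) /\
  (forall E : effectAlgType, lattice_ordered E -> homogeneous E).
Proof.
split; first exact: homogeneous_orthoalgebra.
by split; [exact: homogeneous_riesz | exact: homogeneous_lattice].
Qed.
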